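(* Let $n\geq 4$ be an integer. The minimum coprime number of the square $C_n^2$ of the cycle is given by $$\mathfrak{pr}(C_n^2)=\begin{cases} 4k-1 & \text{if } n=3k, \\ 4k+1 & \text{if } n=3k+1,\\ 4k+3 & \text{if } n=3k+2, \end{cases}$$ where $k$ is an integer.
   Context: $C_n$ is the cycle on $n$ vertices. The $k$-th power $G^k$ of a graph $G$ has the same vertex set as $G$, with an edge between distinct $u,v$ whenever the distance $d(u,v)$ in $G$ is at most $k$. All graphs are finite and simple. A coprime labeling of a graph $G$ of order $N$ is an assignment of distinct labels from $\{1,\ldots,M\}$, for some integer $M\ge N$, to the vertices of $G$ such that adjacent vertices receive relatively prime labels. The minimum coprime number $\mathfrak{pr}(G)$ is the minimum value $M$ for which such a labeling exists. *)

(* Defs.v *)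
From mathcomp Require Import all_boot.
Set Implicit Arguments.
Unset Strict Implicit.
Unset Printing Implicit Defensive.

Record sgraph := SGraph {
  vertex :> finType;
  edge : rel vertex;
  edge_sym : symmetric edge;
  edge_irrefl : irreflexive edge }.

Definition walk_of_length (G : sgraph) (u v : G) (d : nat) : bool :=
  [exists p : d.-tuple G, path (@edge G) u p && (last u p == v)].

(* The least length of a walk from u to v. Only meaningful when u and v are
   connected, in which case some walk has length < #|G|; the value is the
   arbitrary #|G| otherwise. *)
Definition dist (G : sgraph) (u v : G) : nat :=
  find (walk_of_length u v) (iota 0 #|G|).

(* Vertices in different components are at infinite distance: they are
   excluded explicitly since dist is then a junk value. *)
Definition power_edge (G : sgraph) (k : nat) : rel G :=
  [rel u v | [&& u != v, connect (@edge G) u v & dist u v <= k]].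

Lemma walk_of_length_sym (G : sgraph) (u v : G) d :
  walk_of_length u v d = walk_of_length v u d.
Proof.
suff H (x y : G) : walk_of_length x y d -> walk_of_length y x d.
  by apply/idP/idP; apply: H.
case/existsP=> p /andP[xp /eqP <-].
have sz : size (rev (belast x p)) == d by rewrite size_rev size_belast size_tuple.
apply/existsP; exists (Tuple sz) => /=.
rewrite rev_path -(eq_path (e := @edge G)) ?xp /=; last first.
  by move=> a b /=; rewrite edge_sym.
by case: (tval p) => //= a s; rewrite rev_cons last_rcons.
Qed.

Lemma power_edge_sym (G : sgraph) k : symmetric (@power_edge G k).
Proof.
move=> u v; rewrite /power_edge /= eq_sym (sym_connect_sym (@edge_sym G)).
rewrite /dist; congr [&& _, _ & _ <= _].
by apply: eq_find => d; apply: walk_of_length_sym.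
Qed.

Lemma power_edge_irrefl (G : sgraph) k : irreflexive (@power_edge G k).
Proof. by move=> u; rewrite /power_edge /= eqxx. Qed.

Definition power (G : sgraph) (k : nat) : sgraph :=
  SGraph (@power_edge_sym G k) (@power_edge_irrefl G k).

(* ordS is the cyclic successor i |-> i.+1 %% n on 'I_n. The condition u != v
   only matters for n = 1. *)
Definition cycle_edge (n : nat) : rel 'I_n :=
  [rel u v | (u != v) && ((ordS u == v) || (ordS v == u))].

Lemma cycle_edge_sym n : symmetric (@cycle_edge n).
Proof. by move=> u v; rewrite /cycle_edge /= eq_sym orbC. Qed.

Lemma cycle_edge_irrefl n : irreflexive (@cycle_edge n).
Proof. by move=> u; rewrite /cycle_edge /= eqxx. Qed.

Definition cycle_graph (n : nat) : sgraph :=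
  SGraph (@cycle_edge_sym n) (@cycle_edge_irrefl n).

(* 'I_M.+1 is {0, ..., M}; the label 0 is excluded. *)
Definition coprime_labeling (G : sgraph) (M : nat) (f : {ffun G -> 'I_M.+1}) :
    bool :=
  [&& injectiveb f, [forall v, 1 <= f v] &
      [forall u, forall v, edge u v ==> coprime (f u) (f v)]].

Definition has_coprime_labeling (G : sgraph) (M : nat) : bool :=
  (#|G| <= M) && [exists f : {ffun G -> 'I_M.+1}, coprime_labeling f].

Lemma has_coprime_labeling_ex (G : sgraph) : exists M, has_coprime_labeling G M.
Proof.
have [s [sz us ps]] : exists s : seq nat,
    [/\ size s = #|G|, uniq s & all prime s].
  elim: #|G| => [|m [s [sz us ps]]]; first by exists [::].
  have [p lt_p pr_p] := prime_above (\max_(i <- s) i).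
  exists (p :: s); rewrite /= sz us pr_p ps andbT; split=> //.
  apply/negP => sp; move: lt_p; rewrite ltnNge => /negP; apply.
  by rewrite (bigD1_seq p) //= leq_maxl.
have in_s (v : G) : nth 0 s (enum_rank v) \in s by rewrite mem_nth // sz.
pose M := (\max_(i <- s) i) + #|G|.
have leM (v : G) : nth 0 s (enum_rank v) < M.+1.
  rewrite ltnS; apply: leq_trans (leq_addr _ _).
  by rewrite (bigD1_seq _ (in_s v)) //= leq_maxl.
exists M; rewrite /has_coprime_labeling leq_addl /=.
apply/existsP; exists [ffun v => Ordinal (leM v)].
have inj (u v : G) :
    nth 0 s (enum_rank u) = nth 0 s (enum_rank v) -> u = v.
  move=> /eqP; rewrite nth_uniq ?sz // => /eqP uv.
  by apply/enum_rank_inj/val_inj.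
apply/and3P; split.
- apply/injectiveP => u v; rewrite !ffunE => /(congr1 val) /=; exact: inj.
- by apply/forallP => v; rewrite ffunE /= prime_gt0 // (allP ps).
- apply/forallP => u; apply/forallP => v; apply/implyP => uv; rewrite !ffunE /=.
  have pu := allP ps _ (in_s u); have pv := allP ps _ (in_s v).
  rewrite prime_coprime // dvdn_prime2 //; apply/eqP => /inj eq_uv.
  by rewrite eq_uv edge_irrefl in uv.
Qed.

Definition min_coprime_number (G : sgraph) : nat :=
  ex_minn (has_coprime_labeling_ex G).

(* Main.v *)
Require Import Defs.
From mathcomp Require Import all_boot.
From mathcomp Require Import zify.

(** In all three cases the claimed value is [2 * (n - n %/ 3) - 1].

    For the lower bound, the vertices with even labels are pairwise
    non-adjacent in the square of the cycle, so each window of three cyclically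
    consecutive vertices meets at most one of them; averaging over the [n]
    windows leaves at most [n %/ 3] of them
    ([even_labels_sparse]).  The remaining [n - n %/ 3] vertices carry distinct
    odd labels, the largest of which is at least [2 * (n - n %/ 3) - 1].

    For the upper bound, the odd numbers 1, 3, 5, ... are laid out around the
    cycle in increasing order, with an even number [e] inserted between [4j+1]
    and [4j+3]:

       1 e 3 | 5 e 7 | 9 e 11 | ... | 4j+1 e 4j+3 | ...

    Odd labels in adjacent positions or two positions apart differ by 2 or 4,
    hence are coprime.  The neighbours of the
    even number of block [j] are the odd numbers [4j-1], [4j+1], [4j+3] and
    [4j+5].  The natural choice [4j+2] is at distance 1 or 3 from them, and it
    works unless 3 divides it, that is, unless [j] is 1 modulo 3.  In that case
    neither [4j] nor [4j+4] is a multiple of 3, and the only possible common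
    factors are 5 in [4j] and [4j+5], or 5 in [4j+4] and [4j-1]; these two
    accidents exclude each other, so one of the two choices works.  If [j] is the
    last block, [4j+4] may exceed the bound; but then the label [4j+5] is absent
    and [4j] is safe.  Where the cycle closes up, the label 1 is coprime to
    everything, and the label 2 meets only the last label, which is odd.  When
    [n] is not a multiple of 3, one or two further odd labels follow the last
    complete block. *)

Set Implicit Arguments.
Unset Strict Implicit.
Unset Printing Implicit Defensive.

(** * Edges of the square of a cycle *)

(** The search defining [dist] stops at length [#|G|], hence the bound on [d]. *)
Lemma dist_leP (G : sgraph) (u v : G) d : d < #|G| ->
  reflect (exists2 e, e <= d & walk_of_length u v e) (dist u v <= d).
Proof.
move=> ltd; rewrite /dist; apply: (iffP idP) => [le_d | [e le_e w_e]].
- have lt_f : find (walk_of_length u v) (iota 0 #|G|) < #|G|.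
    exact: leq_ltn_trans le_d ltd.
  exists (find (walk_of_length u v) (iota 0 #|G|)) => //.
  have hw : has (walk_of_length u v) (iota 0 #|G|) by rewrite has_find size_iota.
  by move: (nth_find 0 hw); rewrite nth_iota.
- apply: leq_trans le_e; rewrite leqNgt; apply/negP => lt_e.
  move: (before_find 0 lt_e); rewrite nth_iota ?w_e //.
  by apply: leq_trans lt_e _; rewrite -[leqRHS](size_iota 0) find_size.
Qed.

Lemma square_edgeP (G : sgraph) (u v : G) : 2 < #|G| ->
  reflect (u != v /\ (edge u v \/ exists2 w, edge u w & edge w v))
          (edge (s := power G 2) u v).
Proof.
move=> ltG; apply: (iffP and3P) => [[neq_uv _ /(dist_leP _ _ ltG)]|].
- case=> e le_e /existsP[[p szp] /= /andP[pth /eqP last_p]]; split=> //.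
  move: szp le_e => /eqP <-.
  case: p pth last_p => [_ /= eq_uv|x [|y [|]]] //=.
  + by rewrite eq_uv eqxx in neq_uv.
  + by rewrite andbT => ux <-; left.
  + by case/and3P=> ux xy _ <-; right; exists x.
- case=> neq_uv uv; split=> //.
  + case: uv => [uv | [w uw wv]]; first exact: connect1.
    by apply: connect_trans (connect1 uw) (connect1 wv).
  + apply/(dist_leP _ _ ltG); case: uv => [uv | [w uw wv]].
    * exists 1 => //; apply/existsP; exists [tuple v].
      by rewrite /= uv eqxx.
    * exists 2 => //; apply/existsP; exists [tuple w; v].
      by rewrite /= uw wv eqxx.
Qed.

Lemma val_ordS n (u : 'I_n) : ordS u = (if u.+1 == n then 0 else u.+1) :> nat.
Proof.
rewrite /=; case: eqP => [-> | ne]; first by rewrite modnn.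
by rewrite modn_small //; have := ltn_ord u; lia.
Qed.

Section CycleSquare.

Variable n : nat.
Hypothesis n_ge4 : 4 <= n.

Local Notation Csq := (power (cycle_graph n) 2).

Let card_gt2 : 2 < #|cycle_graph n|.
Proof. by rewrite card_ord; lia. Qed.

Lemma ordS_neq (u : 'I_n) : u != ordS u.
Proof. by apply/eqP => /(congr1 (@nat_of_ord n)); rewrite val_ordS; repeat case: ifP; have := ltn_ord u; lia. Qed.

Lemma ordSS_neq (u : 'I_n) : u != ordS (ordS u).
Proof. by apply/eqP => /(congr1 (@nat_of_ord n)); rewrite !val_ordS; repeat case: ifP; have := ltn_ord u; lia. Qed.

Lemma ordS_cycle_edge (u : 'I_n) : edge (s := cycle_graph n) u (ordS u).
Proof. by apply/andP; split; [exact: ordS_neq | rewrite eqxx]. Qed.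

Lemma ordS_edge (u : 'I_n) : edge (s := Csq) u (ordS u).
Proof.
apply/square_edgeP=> //; split; first exact: ordS_neq.
by left; apply: ordS_cycle_edge.
Qed.

Lemma ordSS_edge (u : 'I_n) : edge (s := Csq) u (ordS (ordS u)).
Proof.
apply/square_edgeP=> //; split; first exact: ordSS_neq.
by right; exists (ordS u); apply: ordS_cycle_edge.
Qed.

Lemma cycle_square_edge (u v : 'I_n) : edge (s := Csq) u v ->
  (v = ordS u \/ v = ordS (ordS u)) \/ (u = ordS v \/ u = ordS (ordS v)).
Proof.
case/square_edgeP=> // neq_uv [/andP[_ /orP[]/eqP <-] | [w]]; try by auto.
move=> /andP[_ /orP[]/eqP uw] /andP[_ /orP[]/eqP wv].
- by left; right; rewrite uw wv.
- by move: uw neq_uv; rewrite -wv => /ordS_inj ->; rewrite eqxx.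
- by move: neq_uv; rewrite -uw wv eqxx.
- by right; right; rewrite wv uw.
Qed.

(** * The lower bound *)

Section LowerBound.

Variables (M : nat) (f : {ffun Csq -> 'I_M.+1}).
Hypothesis f_lab : coprime_labeling f.

(** Double counting of the pairs formed by an even vertex and a window of three
    consecutive vertices containing it. *)
Lemma even_labels_sparse : 3 * #|[pred v : 'I_n | ~~ odd (f v)]| <= n.
Proof.
have [_ _ /forallP cop] := and3P f_lab.
pose e (v : 'I_n) : nat := ~~ odd (f v).
have edge_odd (u v : 'I_n) : edge (s := Csq) u v -> e u + e v <= 1.
  move=> uv; have /forallP/(_ v)/implyP/(_ uv) := cop u.
  rewrite /e; case: (boolP (odd (f u))) => eu; case: (boolP (odd (f v))) => ev //.
  have d2 : 2 %| gcdn (f u) (f v) by rewrite dvdn_gcd !dvdn2 eu ev.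
  by move=> /eqP g1; rewrite g1 in d2.
have window v : e v + (e (ordS v) + e (ordS (ordS v))) <= 1.
  have := edge_odd _ _ (ordS_edge v); have := edge_odd _ _ (ordSS_edge v).
  have := edge_odd _ _ (ordS_edge (ordS v)); lia.
have shift (g : 'I_n -> nat) : \sum_v g (ordS v) = \sum_v g v.
  by rewrite [RHS](reindex_inj (@ordS_inj n)).
have -> : #|[pred v : 'I_n | ~~ odd (f v)]| = \sum_v e v.
  by rewrite -sum1_card big_mkcond; apply: eq_bigr => v _; rewrite inE /e; case: odd.
have: \sum_v (e v + (e (ordS v) + e (ordS (ordS v)))) <= \sum_(v : 'I_n) 1.
  exact: leq_sum.
rewrite !big_split /= (shift (fun v => e (ordS v))) !(shift e).
by rewrite sum1_card card_ord 3!mulSn mul0n addn0.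
Qed.

Lemma odd_labels_bound : #|[pred v : 'I_n | odd (f v)]| <= uphalf M.
Proof.
have [/injectiveP inj _ _] := and3P f_lab.
have lt_half (v : 'I_n) : odd (f v) -> (f v)./2 < uphalf M.
  by have := ltn_ord (f v); lia.
pose D := {v : 'I_n | odd (f v)}.
pose h (v : D) : 'I_(uphalf M) := Ordinal (lt_half (val v) (valP v)).
have h_inj : injective h.
  move=> u v /(congr1 val) /= eq_half; apply/val_inj/inj/val_inj => /=.
  by have := valP u; have := valP v; move=> /=; lia.
by have := leq_card h h_inj; rewrite card_sig card_ord.
Qed.

Lemma coprime_labeling_bound : 2 * (n - n %/ 3) - 1 <= M.
Proof.
have := even_labels_sparse; have := odd_labels_bound.
have := cardC [pred v : 'I_n | odd (f v)]; rewrite card_ord.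
have -> : #|[predC [pred v : 'I_n | odd (f v)]]|
          = #|[pred v : 'I_n | ~~ odd (f v)]| by apply: eq_card => v; rewrite !inE.
by move: #|_| #|_| => O E; lia.
Qed.

End LowerBound.

End CycleSquare.

(** * The labeling *)

(** A common prime factor of two numbers divides their difference. *)
Lemma coprime_of_gap a b d : a < b -> b <= a + d ->
  (forall p, prime p -> p <= d -> p %| a -> ~~ (p %| b)) -> coprime a b.
Proof.
move=> lt_ab le_b small; rewrite /coprime eqn_leq gcdn_gt0 (leq_ltn_trans _ lt_ab) //.
rewrite orbT andbT leqNgt; apply/negP => /pdivP[p pr_p].
rewrite dvdn_gcd => /andP[pa pb].
have p_le : p <= b - a by rewrite dvdn_leq ?subn_gt0 ?dvdn_sub.
have p_le_d : p <= d by apply: leq_trans p_le _; lia.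
by apply/negP: pb; apply: small.
Qed.

(** In the labeling below, labels one or two positions apart differ by at most 5
    as long as the cycle does not close between them, so 2, 3 and 5 are the only
    primes to test; these tests are in the scope of linear arithmetic. *)
Lemma coprime_near a b : a != b -> a <= b + 5 -> b <= a + 5 ->
  [&& ~~ [&& 2 %| a & 2 %| b], ~~ [&& 3 %| a & 3 %| b]
    & ~~ [&& 5 %| a & 5 %| b]] -> coprime a b.
Proof.
wlog lt_ab : a b / a < b.
  move=> H neq_ab le_ab le_ba; case: (ltngtP a b) neq_ab => // [lt|lt] _.
    by apply: H; lia.
  by rewrite coprime_sym => h; apply: H; lia.
move=> _ _ le_b /and3P[n2 n3 n5]; apply: (coprime_of_gap lt_ab le_b).
by case=> [|[|[|[|[|[|]]]]]] // _ _ pa; rewrite pa in n2 n3 n5.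
Qed.

(** The even number placed between [4j+1] and [4j+3].  When [j] is 1 modulo 3 the
    choice is between [4j], which may share the factor 5 with [4j+5], and
    [4j+4], which may share it with [4j-1].  The label [4j+5] is present
    exactly when position [3j+3] is. *)
Definition even_label (n j : nat) : nat :=
  if j %% 3 != 1 then 4 * j + 2
  else if (5 %| j) && (3 * j + 3 < n) then 4 * j + 4 else 4 * j.

(** The test [p.+1 == n] skips the even number of an incomplete last block: for
    [n = 3k+2] the cycle closes with the two odd labels [4k+1] and [4k+3]. *)
Definition label (n p : nat) : nat :=
  if p %% 3 == 0 then 4 * (p %/ 3) + 1
  else if (p %% 3 == 2) || (p.+1 == n) then 4 * (p %/ 3) + 3
  else even_label n (p %/ 3).

Lemma label_gt0 n p : 0 < label n p.
Proof. by rewrite /label /even_label; repeat case: ifP; lia. Qed.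

Lemma label_bound n p : p < n -> label n p <= 2 * (n - n %/ 3) - 1.
Proof. by rewrite /label /even_label; repeat case: ifP; lia. Qed.

(** Even labels of different blocks could only collide as [4j+4 = 4(j+1)], but
    [j] and [j+1] are not both 1 modulo 3. *)
Lemma label_inj n p q : p < n -> q < n -> label n p = label n q -> p = q.
Proof. by rewrite /label /even_label; repeat case: ifP; lia. Qed.

Lemma label_coprime_next n p : p.+1 < n -> coprime (label n p) (label n p.+1).
Proof. by move=> ltp; apply: coprime_near; rewrite /label /even_label; repeat case: ifP; lia. Qed.

Lemma label_coprime_next2 n p : p.+2 < n -> coprime (label n p) (label n p.+2).
Proof. by move=> ltp; apply: coprime_near; rewrite /label /even_label; repeat case: ifP; lia. Qed.

Lemma label_coprime_last n : 3 < n -> coprime (label n n.-1) (label n 1).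
Proof.
move=> n_gt3; have -> : label n 1 = 2 by rewrite /label /even_label; repeat case: ifP; lia.
by rewrite coprimen2 /label /even_label; repeat case: ifP; lia.
Qed.

Section CycleLabeling.

Variable n : nat.
Hypothesis n_ge4 : 4 <= n.

Let M := 2 * (n - n %/ 3) - 1.

Lemma label_coprime_ordS (u : 'I_n) : coprime (label n u) (label n (ordS u)).
Proof.
rewrite val_ordS; case: eqP => [_ | last_u]; first by rewrite coprimen1.
by apply: label_coprime_next; have := ltn_ord u; lia.
Qed.

Lemma label_coprime_ordSS (u : 'I_n) :
  coprime (label n u) (label n (ordS (ordS u))).
Proof.
rewrite !val_ordS; have ltu := ltn_ord u.
have [last_u | last_u] := eqVneq u.+1 n.
- have -> : (if 1 == n then 0 else 1) = 1 by case: eqP; lia.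
  have -> : nat_of_ord u = n.-1 by lia.
  exact: label_coprime_last.
- case: eqP => [_ | last_u']; first by rewrite coprimen1.
  by apply: label_coprime_next2; lia.
Qed.

Lemma cycle_square_has_labeling :
  has_coprime_labeling (power (cycle_graph n) 2) M.
Proof.
have lt_label (v : 'I_n) : label n v < M.+1 by apply: label_bound.
apply/andP; split; first by rewrite card_ord /M; lia.
apply/existsP; exists [ffun v : 'I_n => Ordinal (lt_label v)].
apply/and3P; split.
- apply/injectiveP => u v; rewrite !ffunE => /(congr1 val) /= eq_uv.
  by apply/val_inj; apply: label_inj eq_uv.
- by apply/forallP => v; rewrite ffunE /= label_gt0.
- apply/forallP => u; apply/forallP => v; apply/implyP => uv; rewrite !ffunE /=.
  case: (cycle_square_edge n_ge4 uv) => [] [] ->.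
  + exact: label_coprime_ordS.
  + exact: label_coprime_ordSS.
  + by rewrite coprime_sym; exact: label_coprime_ordS.
  + by rewrite coprime_sym; exact: label_coprime_ordSS.
Qed.

(** * The minimum coprime number *)

Lemma min_coprime_cycle_square :
  min_coprime_number (power (cycle_graph n) 2) = M.
Proof.
rewrite /min_coprime_number; case: ex_minnP => m lab_m min_m.
apply/eqP; rewrite eqn_leq min_m ?cycle_square_has_labeling //=.
by case/andP: lab_m => _ /existsP[f]; apply: coprime_labeling_bound.
Qed.

End CycleLabeling.

Theorem theorem15 (n k : nat) (hn : 4 <= n) :
  [/\ n = 3 * k -> min_coprime_number (power (cycle_graph n) 2) = 4 * k - 1,
      n = 3 * k + 1 -> min_coprime_number (power (cycle_graph n) 2) = 4 * k + 1
    & n = 3 * k + 2 -> min_coprime_number (power (cycle_graph n) 2) = 4 * k + 3].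
Proof. by rewrite min_coprime_cycle_square //; split; lia. Qed.
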